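(* Let $I\subset\mathbb{R}$ be a nondegenerate interval, let $\omega=(\omega_1,\omega_2):I\to\mathbb{R}^2$ be a $2$-dimensional positive Chebyshev system over $I$, and let $\omega_3:I\to\mathbb{R}$ be such that $\omega^*=(\omega_1,\omega_2,\omega_3)$ is a $3$-dimensional positive Chebyshev system over $I$. Let $(t_1,t_2)\in\mathbb{R}_+^2$. Then a function $f:I\to\mathbb{R}$ is symmetrically $((t_1,t_2),\omega)$-convex on $I$ if and only if, for all $p\in I$, there exists an interval $U\subseteq I$ that is a neighborhood of $p$ in $I$ such that $f$ is symmetrically $((t_1,t_2),\omega)$-convex on $U$.
   Context: $\mathbb{R}_+$ is the set of positive reals. $\sigma_k(I):=\{(x_1,\dots,x_k)\in I^k\mid x_1<\dots<x_k\}$. For $\omega=(\omega_1,\dots,\omega_k):I\to\mathbb{R}^k$ and $(x_1,\dots,x_k)\in\sigma_k(I)$, $\Phi_\omega(x_1,\dots,x_k):=\det\big(\omega_i(x_j)\big)_{i,j=1}^k$. $\omega$ is a $k$-dimensional positive Chebyshev system over $I$ if $\Phi_\omega>0$ on $\sigma_k(I)$. For $\omega=(\omega_1,\omega_2)$ and $f:I\to\mathbb{R}$, $(\omega,f):=(\omega_1,\omega_2,f)$. For $(s_1,s_2)\in\mathbb{R}_+^2$ and a nondegenerate interval $J\subseteq I$, $f$ is $((s_1,s_2),\omega)$-convex on $J$ if $\Phi_{(\omega,f)}(x,x+s_1h,x+(s_1+s_2)h)\ge0$ for all $h>0$ and $x\in J$ with $x+(s_1+s_2)h\in J$; $f$ is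 symmetrically $((t_1,t_2),\omega)$-convex on $J$ if it is both $((t_1,t_2),\omega)$-convex and $((t_2,t_1),\omega)$-convex on $J$. (The auxiliary function $\omega_3$ is part of the paper's standing setting; it does not enter the equivalence.) *)

(* Defs.v *)
From mathcomp Require Import all_boot all_order all_algebra.
From mathcomp Require Import all_classical all_reals all_analysis.
Set Implicit Arguments.
Unset Strict Implicit.
Unset Printing Implicit Defensive.
Import Order.TTheory GRing.Theory Num.Theory.
Import numFieldNormedType.Exports.
Local Open Scope classical_set_scope.
Local Open Scope ring_scope.

(* Functions on an interval I are total functions R -> R; all the notions below
   only evaluate them at points of the given set. *)

Definition nondegenerate_interval (R : realType) (I : set R) : Prop :=
  is_interval I /\ exists x y : R, [/\ I x, I y & x < y].

Definition sigma (R : realType) (k : nat) (I : set R) : set (k.-tuple R) :=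
  [set x | (forall i : 'I_k, I (tnth x i)) /\ sorted <%R x].

Definition Phi (R : realType) (k : nat) (w : k.-tuple (R -> R))
    (x : k.-tuple R) : R :=
  \det (\matrix_(i < k, j < k) (tnth w i) (tnth x j)).

Definition positive_Chebyshev (R : realType) (k : nat) (I : set R)
    (w : k.-tuple (R -> R)) : Prop :=
  forall x : k.-tuple R, sigma I x -> 0 < Phi w x.

Definition extend (R : realType) (k : nat) (w : k.-tuple (R -> R))
    (f : R -> R) : k.+1.-tuple (R -> R) :=
  [tuple of rcons w f].

Definition st_convex (R : realType) (s1 s2 : R) (w : 2.-tuple (R -> R))
    (J : set R) (f : R -> R) : Prop :=
  forall h x : R, 0 < h -> J x -> J (x + (s1 + s2) * h) ->
    0 <= Phi (extend w f) [tuple x; x + s1 * h; x + (s1 + s2) * h].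

Definition sym_convex (R : realType) (t1 t2 : R) (w : 2.-tuple (R -> R))
    (J : set R) (f : R -> R) : Prop :=
  st_convex t1 t2 w J f /\ st_convex t2 t1 w J f.

(* Main.v *)
Require Import Defs.
From mathcomp Require Import all_boot all_order all_algebra.
From mathcomp Require Import all_classical all_reals all_analysis.
From mathcomp Require Import ring lra.
Set Implicit Arguments.
Unset Strict Implicit.
Unset Printing Implicit Defensive.
Import Order.TTheory GRing.Theory Num.Theory.
Import numFieldNormedType.Exports.
Local Open Scope classical_set_scope.
Local Open Scope ring_scope.

(** Suppose [Phi] is negative at [x < y < z] with [y - x : z - y = s1 : s2].
    Divide [[x, y]] at [u] in the ratio [s2 : s1] and [[y, z]] at [v] in the
    ratio [s1 : s2]; then [y] divides [[u, v]] in the ratio [s1 : s2]. Since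
    [Phi (x, y, z)] is a positive combination of [Phi (x, u, y)],
    [Phi (u, y, v)] and [Phi (y, v, z)], one of these is negative as well, and
    the lengths have shrunk by a fixed factor. Iterating gives nested intervals
    shrinking to a point at which local convexity fails. *)

Lemma Phi2E (R : realType) (w : 2.-tuple (R -> R)) (x y : R) :
  Phi w [tuple x; y] =
  tnth w 0 x * tnth w 1 y - tnth w 0 y * tnth w 1 x.
Proof.
rewrite /Phi (expand_det_row _ ord0) !big_ord_recl big_ord0 /cofactor.
case/tupleP: w => a w; case/tupleP: w => b w; rewrite (tuple0 w).
rewrite !det_mx11 !mxE /= !(tnth_nth a) !(tnth_nth 0) /=; ring.
Qed.

Lemma Phi_extendE (R : realType) (w : 2.-tuple (R -> R)) (f : R -> R)
    (x y z : R) :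
  Phi (extend w f) [tuple x; y; z] =
  f x * Phi w [tuple y; z] - f y * Phi w [tuple x; z]
  + f z * Phi w [tuple x; y].
Proof.
rewrite !Phi2E; case/tupleP: w => a w; case/tupleP: w => b w.
rewrite (tuple0 w) /Phi (expand_det_row _ ord0) !big_ord_recl big_ord0.
rewrite /cofactor !(expand_det_row _ ord0) !big_ord_recl !big_ord0 /cofactor.
rewrite !det_mx11 !mxE /= !(tnth_nth a) !(tnth_nth 0) /=; ring.
Qed.

(** Expanding each [F] along the row of [f], the terms in [f u] and [f v] cancel, and the
    coefficients of [f y] agree by two Plucker relations between the 2x2 minors [D]. *)
Lemma Phi_extend_refine (R : realType) (w : 2.-tuple (R -> R)) (f : R -> R)
    (x u y v z : R) :
  let D p q := Phi w [tuple p; q] in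
  let F p q r := Phi (extend w f) [tuple p; q; r] in
  D u y * D y v * F x y z =
  D y v * D y z * F x u y + D x y * D y z * F u y v + D u y * D x y * F y v z.
Proof. by rewrite /= !Phi_extendE !Phi2E; ring. Qed.

Lemma positive_Chebyshev2 (R : realType) (I : set R) (w : 2.-tuple (R -> R))
    (x y : R) :
  positive_Chebyshev I w -> I x -> I y -> x < y -> 0 < Phi w [tuple x; y].
Proof.
move=> hw Ix Iy xy; apply: hw; split; last by rewrite /= xy.
by move=> i; rewrite (tnth_nth 0); case: i => -[|[|]].
Qed.

Lemma Phi_extend_neg_refine (R : realType) (I : set R) (w : 2.-tuple (R -> R))
    (f : R -> R) (x u y v z : R) :
  positive_Chebyshev I w -> [/\ I x, I u, I y, I v & I z] ->
  [/\ x < u, u < y, y < v & v < z] ->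
  Phi (extend w f) [tuple x; y; z] < 0 ->
  [\/ Phi (extend w f) [tuple x; u; y] < 0,
      Phi (extend w f) [tuple u; y; v] < 0 |
      Phi (extend w f) [tuple y; v; z] < 0].
Proof.
move=> hw [Ix Iu Iy Iv Iz] [xu uy yv vz] neg.
have [|h1] := ltP (Phi (extend w f) [tuple x; u; y]) 0; first by constructor 1.
have [|h2] := ltP (Phi (extend w f) [tuple u; y; v]) 0; first by constructor 2.
have [|h3] := ltP (Phi (extend w f) [tuple y; v; z]) 0; first by constructor 3.
have Dxy := positive_Chebyshev2 hw Ix Iy (lt_trans xu uy).
have Duy := positive_Chebyshev2 hw Iu Iy uy.
have Dyv := positive_Chebyshev2 hw Iy Iv yv.
have Dyz := positive_Chebyshev2 hw Iy Iz (lt_trans yv vz).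
have := Phi_extend_refine w f x u y v z => /= E.
suff : 0 <= Phi (extend w f) [tuple x; y; z] by rewrite leNgt neg.
rewrite -(pmulr_rge0 _ (mulr_gt0 Duy Dyv)) E.
by rewrite !addr_ge0 // !mulr_ge0 // ltW.
Qed.

Section Subdivision.
Variables (R : realType) (I : set R) (w : 2.-tuple (R -> R)) (f : R -> R).
Hypotheses (itvI : is_interval I) (hw : positive_Chebyshev I w).

Definition violation (s1 s2 x h : R) : Prop :=
  [/\ 0 < h, I x, I (x + (s1 + s2) * h) &
      Phi (extend w f) [tuple x; x + s1 * h; x + (s1 + s2) * h] < 0].

(** The left subtriple has its ratio reversed to [s2 : s1], while the middle and right ones keep
    [s1 : s2]; hence the two orders in the conclusion. *)
Lemma violation_refine (s1 s2 x h : R) : 0 < s1 -> 0 < s2 ->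
  violation s1 s2 x h ->
  exists x' h' : R,
    [/\ violation s1 s2 x' h' \/ violation s2 s1 x' h', x <= x',
        x' + (s1 + s2) * h' <= x + (s1 + s2) * h &
        h' <= Num.max s1 s2 / (s1 + s2) * h].
Proof.
move=> s10 s20 [h0 Ix Iz neg].
have T0 : 0 < s1 + s2 by lra.
have Tn0 : s1 + s2 != 0 by rewrite gt_eqF.
(* These are the scales of the subtriples: [[x, y]] has length [(s1 + s2) * q1] and [[y, z]] has
   length [(s1 + s2) * q2]. *)
pose q1 := s1 / (s1 + s2) * h; pose q2 := s2 / (s1 + s2) * h.
have q10 : 0 < q1 by rewrite !mulr_gt0 ?invr_gt0.
have q20 : 0 < q2 by rewrite !mulr_gt0 ?invr_gt0.
have q1E : (s1 + s2) * q1 = s1 * h by rewrite /q1; field.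
have q2E : (s1 + s2) * q2 = s2 * h by rewrite /q2; field.
(* This says [v - y = s2 * q1]; as [y - u = s1 * q1], the middle triple has scale [q1]. *)
have qC : s1 * q2 = s2 * q1 by rewrite /q1 /q2; field.
have q1M : q1 <= Num.max s1 s2 / (s1 + s2) * h.
  by rewrite !ler_wpM2r ?invr_ge0 ?le_max ?lexx // ltW.
have q2M : q2 <= Num.max s1 s2 / (s1 + s2) * h.
  by rewrite !ler_wpM2r ?invr_ge0 ?le_max ?lexx ?orbT // ltW.
have s1q1 := mulr_gt0 s10 q10; have s2q1 := mulr_gt0 s20 q10.
have s2q2 := mulr_gt0 s20 q20.
have Iin t : 0 <= t -> t <= (s1 + s2) * h -> I (x + t).
  by move=> t0 tT; apply: (itvI Ix Iz); lra.
have Iu : I (x + s2 * q1) by apply: Iin; lra.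
have Iy : I (x + s1 * h) by apply: Iin; lra.
have Iv : I (x + s1 * h + s1 * q2) by rewrite -addrA; apply: Iin; lra.
have [||neg'|neg'|neg'] := @Phi_extend_neg_refine _ _ _ f x (x + s2 * q1)
  (x + s1 * h) (x + s1 * h + s1 * q2) (x + (s1 + s2) * h) hw _ _ neg.
- by [].
- by split; lra.
- exists x, q1; split=> //; [right|lra].
  have E : x + (s2 + s1) * q1 = x + s1 * h by lra.
  by split; rewrite ?E.
- exists (x + s2 * q1), q1; split=> //; [left|lra|lra].
  have E1 : x + s2 * q1 + s1 * q1 = x + s1 * h by lra.
  have E2 : x + s2 * q1 + (s1 + s2) * q1 = x + s1 * h + s1 * q2 by lra.
  by split; rewrite ?E1 ?E2.
- exists (x + s1 * h), q2; split=> //; [left|lra|lra].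
  have E : x + s1 * h + (s1 + s2) * q2 = x + (s1 + s2) * h by lra.
  by split; rewrite ?E.
Qed.

Variables t1 t2 : R.
Hypotheses (t10 : 0 < t1) (t20 : 0 < t2).

Let sym_violation (a : R * R) : Prop :=
  violation t1 t2 a.1 a.2 \/ violation t2 t1 a.1 a.2.

Let T := t1 + t2.
Let r := Num.max t1 t2 / T.

Lemma sym_violation_refine (a : R * R) : sym_violation a ->
  exists b : R * R,
    [/\ sym_violation b, a.1 <= b.1, b.1 + T * b.2 <= a.1 + T * a.2 &
        b.2 <= r * a.2].
Proof.
case=> /violation_refine [] // x [h [vio le1 le2 le3]]; exists (x, h).
  by split.
(* In the reversed order the same bounds result, because [T] and [r] are symmetric in [t1] and
   [t2]. *)
split; rewrite /sym_violation /r /T /= 1?maxC 1?(addrC t1) //.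
by case: vio; auto.
Qed.

(** Nested intervals: [p] is the supremum of the left ends of the iterated refinements, and the
    lengths decay geometrically because [r < 1]. *)
Lemma sym_violation_cluster (a : R * R) : sym_violation a ->
  exists2 p : R, I p & forall e : R, 0 < e ->
    exists b : R * R,
      [/\ sym_violation b, p - e < b.1 <= p & p <= b.1 + T * b.2 < p + e].
Proof.
move=> va.
have T0 : 0 < T by rewrite addr_gt0.
have r0 : 0 <= r by rewrite divr_ge0 ?le_max ?ltW.
have r1 : r < 1.
  by rewrite ltr_pdivrMr // mul1r gt_max /T ltrDl t20 ltrDr t10.
(* To be total, the choice function may take any value, such as [b] itself, where [b] is no
   violation. *)
have /choice[step stepP] : forall b : R * R, exists c : R * R,
    sym_violation b -> [/\ sym_violation c, b.1 <= c.1,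
      c.1 + T * c.2 <= b.1 + T * b.2 & c.2 <= r * b.2].
  move=> b; have [vb|] := pselect (sym_violation b); last by exists b.
  by have [c] := sym_violation_refine vb; exists c.
pose s n := iter n step a.
have vs n : sym_violation (s n).
  by elim: n => // n IH; have [] := stepP _ IH.
have s2_gt0 n : 0 < (s n).2 by case: (vs n) => -[].
have lo m n : (m <= n)%N -> (s m).1 <= (s n).1.
  apply: (homo_leq (f := fun n => (s n).1) (r := fun x y => x <= y)) => //.
    by move=> y x z; apply: le_trans.
  by move=> i; have [] := stepP _ (vs i).
have hi m n : (m <= n)%N -> (s n).1 + T * (s n).2 <= (s m).1 + T * (s m).2.
  apply: (homo_leq (f := fun n => (s n).1 + T * (s n).2)
    (r := fun x y => y <= x)) => //.
    by move=> y x z xy yz; apply: le_trans yz xy.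
  by move=> i; have [] := stepP _ (vs i).
have small n : (s n).2 <= a.2 * r ^+ n.
  elim: n => [|n IH]; first by rewrite expr0 mulr1.
  have [_ _ _ /le_trans] := stepP _ (vs n); apply.
  by rewrite exprS mulrCA ler_wpM2l.
have lohi m n : (s m).1 <= (s n).1 + T * (s n).2.
  apply: (@le_trans _ _ (s (maxn m n)).1); first exact/lo/leq_maxl.
  apply: le_trans (hi _ _ (leq_maxr m n)).
  by rewrite lerDl mulr_ge0 // ltW.
pose X := range (fun n => (s n).1).
have X0 : X !=set0 by exists (s 0%N).1, 0%N.
have Xub n : ubound X ((s n).1 + T * (s n).2) by move=> _ [m _ <-].
have lep n : (s n).1 <= sup X.
  by apply: ub_le_sup; [exists ((s 0%N).1 + T * (s 0%N).2) | exists n].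
have gep n : sup X <= (s n).1 + T * (s n).2 by apply: ge_sup.
exists (sup X).
  have [Ix Iz] : I (s 0%N).1 /\ I ((s 0%N).1 + T * (s 0%N).2).
    by rewrite /T; case: (vs 0%N) => -[_ ? + _]; rewrite 1?(addrC t2).
  by apply: (itvI Ix Iz); rewrite lep gep.
move=> e e0.
have /cvgrPdist_lt/(_ e e0) : T * a.2 * r ^+ n @[n --> \oo] --> (0 : R).
  rewrite -(mulr0 (T * a.2)); apply: cvgM; first exact: cvg_cst.
  by apply: cvg_expr; rewrite ger0_norm.
case=> N _ /(_ N (leqnn N)) /=; rewrite sub0r normrN.
move=> /(le_lt_trans (ler_norm _)) ltN.
have len : T * (s N).2 < e.
  by apply: le_lt_trans ltN; rewrite -mulrA ler_pM2l.
exists (s N); split=> //; first by apply/andP; split; [have := gep N; lra|].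
by apply/andP; split=> //; have := lep N; lra.
Qed.

End Subdivision.

Theorem corollary18 (R : realType) (I : set R)
    (hI : nondegenerate_interval I)
    (w : 2.-tuple (R -> R)) (hw : positive_Chebyshev I w)
    (w3 : R -> R) (hw3 : positive_Chebyshev I (extend w w3))
    (t1 t2 : R) (ht1 : 0 < t1) (ht2 : 0 < t2) (f : R -> R) :
  sym_convex t1 t2 w I f <->
  (forall p : R, I p ->
     exists U : set R,
       [/\ nondegenerate_interval U, U `<=` I, within I (nbhs p) U
         & sym_convex t1 t2 w U f]).
Proof.
split=> [cvx p Ip|loc].
  by exists I; split=> //; apply: withinT.
suff novio (a : R * R) :
    ~ (violation I w f t1 t2 a.1 a.2 \/ violation I w f t2 t1 a.1 a.2).
  split=> h x h0 Ix Iz; rewrite leNgt; apply/negP => neg;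
    by apply: (novio (x, h)); [left + right].
(* A violation anywhere produces violations arbitrarily close to some [p] in [I]; one with both ends
   within [e] of [p] lies in [U] and contradicts convexity there. *)
case: hI => itvI _ /(sym_violation_cluster itvI hw ht1 ht2)[p Ip clu].
have [U [_ _ /nbhs_ballP[e /= e0 ballU] [cvx1 cvx2]]] := loc p Ip.
have [b [vb /andP[lo1 lo2] /andP[hi1 hi2]]] := clu e e0.
have inU y : I y -> p - e < y -> y < p + e -> U y.
  by move=> Iy ly yu; apply: ballU => //; rewrite /ball /= ltr_distlC ly yu.
case: vb => -[h0 Ix Iz]; rewrite ltNge => /negP; apply.
  by apply: cvx1 => //; apply: inU => //; lra.
by apply: cvx2 => //; apply: inU => //; lra.
Qed.
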